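(* Let $S$ be a nonempty set and $g:S\to S$ a map. For $m\ge 1$ write $g^1=g$, $g^m=g\circ g^{m-1}$. (1) Suppose that for every positive integer $m$ the equation $g^m(x)=x$ has only finitely many distinct solutions $x\in S$, and let $\phi(m)$ denote the number of these solutions. Then for every positive integer $m$, the number of periodic points of $g$ with least period $m$ equals $\Phi_1(m,\phi)$. Consequently $\Phi_1(m,\phi)\equiv 0 \pmod m$ for every positive integer $m$. (2) Suppose $S\subseteq\mathbb{R}$ with $0\in S$ and $-x\in S$ for all $x\in S$, that $g$ is odd (i.e. $g(-x)=-g(x)$ for all $x\in S$), and that for every positive integer $m$ the equation $g^m(x)=-x$ has only finitely many distinct solutions $x\in S$; let $\psi(m)$ denote the number of these solutions. Then for every positive integer $m$, the number of symmetric periodic points of $g$ with least period $2m$ equals $\Phi_2(m,\psi)$. Consequently $\Phi_2(m,\psi)\equiv 0 \pmod{2m}$ for every positive integer $m$.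
   Context: A point $y\in S$ is a periodic point of $g$ if $g^m(y)=y$ for some positive integer $m$; the smallest such $m$ is its least period. The orbit of $y$ is $\{g^k(y): k\ge 0\}$. A symmetric periodic point is a periodic point whose orbit $O$ is symmetric with respect to the origin, i.e. $-O=O$. For an integer-valued function $\phi$ on the positive integers: $\Phi_1(1,\phi)=\phi(1)$, and if $m=p_1^{k_1}\cdots p_r^{k_r}$ with $p_1,\dots,p_r$ distinct primes and $r,k_i\ge1$, then $$\Phi_1(m,\phi)=\sum_{T\subseteq\{1,\dots,r\}}(-1)^{|T|}\,\phi\Big(\frac{m}{\prod_{i\in T}p_i}\Big)$$ (empty product $=1$). For an integer-valued function $\psi$ on the positive integers: if $m=2^{k_0}p_1^{k_1}\cdots p_r^{k_r}$ where $p_1,\dots,p_r$ are distinct odd primes, $k_0\ge0$, $r\ge1$, $k_i\ge1$, then $$\Phi_2(m,\psi)=\sum_{T\subseteq\{1,\dots,r\}}(-1)^{|T|}\,\psi\Big(\frac{m}{\prod_{i\in T}p_i}\Big);$$ if $m=2^k$ with $k\ge0$, then $\Phi_2(m,\psi)=\psi(m)-1$. *)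

(* Defs.v *)
From mathcomp Require Import all_boot all_order all_algebra finmap.
From mathcomp Require Import boolp classical_sets functions cardinality reals.

Set Implicit Arguments.
Unset Strict Implicit.
Unset Printing Implicit Defensive.

Import Order.TTheory GRing.Theory Num.Theory.

Local Open Scope classical_set_scope.
Local Open Scope ring_scope.

(* Meaningful for finite A only: [fset_set] sends an infinite set to [fset0].
   [{classic T}] is T with the choiceType structure given by classical choice. *)
Definition ncard (T : Type) (A : set T) : nat :=
  #|` fset_set (A : set {classic T}) |%fset.

Section Dynamics.
Variables (S : Type) (g : S -> S).

Definition periodic_point (y : S) : Prop :=
  exists2 m : nat, (0 < m)%N & iter m g y = y.

Definition least_period (y : S) (m : nat) : Prop :=
  [/\ (0 < m)%N, iter m g y = y
    & forall k : nat, (0 < k)%N -> iter k g y = y -> (m <= k)%N].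

Definition orbit_set (y : S) : set S := [set iter k g y | k in [set: nat]].

End Dynamics.

Definition symmetric_periodic_point (R : realType) (S : set R) (g : S -> S)
    (y : S) : Prop :=
  let O : set R := [set val z | z in orbit_set g y] in
  periodic_point g y /\ [set - z | z in O] = O.

(* The sum over subsets T of the indices of ps = [:: p_1; ...; p_r]. *)
Definition alt_sum (ps : seq nat) (m : nat) (phi : nat -> int) : int :=
  \sum_(T : {set 'I_(size ps)})
    (-1) ^+ #|T| * phi (m %/ \prod_(i in T) nth 1%N ps i)%N.

Definition Phi1 (m : nat) (phi : nat -> int) : int :=
  if m == 1%N then phi 1%N else alt_sum (primes m) m phi.

Definition Phi2 (m : nat) (psi : nat -> int) : int :=
  if m == (2 ^ logn 2 m)%N then psi m - 1
  else alt_sum [seq p <- primes m | odd p] m psi.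

(* Main.v *)
Require Import Defs.
From mathcomp Require Import all_boot all_order all_algebra finmap.
From mathcomp Require Import boolp classical_sets functions cardinality reals.

Set Implicit Arguments.
Unset Strict Implicit.
Unset Printing Implicit Defensive.

Import Order.TTheory GRing.Theory Num.Theory.

Local Open Scope classical_set_scope.
Local Open Scope ring_scope.

(** Let d be the least period of x and let g^n x = x. For q dividing n,
    g^(n/q) x = x iff q divides n/d, so for distinct primes p_i the solutions of
    g^(n / prod_(i in T) p_i) x = x are the common solutions of the equations
    g^(n/p_i) x = x, i in T. By inclusion-exclusion the alternating sum counts
    the solutions of g^n x = x that solve none of the equations g^(n/p_i) x = x;
    for n = m these are the points of least period m.

    For odd g and odd q dividing m, g^(m/q) x = -x iff g^m x = -x and
    g^(2m/q) x = x, so the same argument applies with n = 2m and the odd primes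
    dividing m. The remaining prime 2 only excludes the origin, which already
    cancels in the alternating sum unless m is a power of 2. The congruences hold
    because the points counted split into orbits of m, respectively 2m, points. *)

(** * Least periods and divisibility *)

Lemma iter_dvdn (S : Type) (g : S -> S) (x : S) (n k : nat) :
  iter n g x = x -> (n %| k)%N -> iter k g x = x.
Proof. by move=> gx /dvdnP[q ->]; rewrite iterM; elim: q => //= q ->. Qed.

Lemma ex_least_period (S : Type) (g : S -> S) (x : S) (n : nat) :
  (0 < n)%N -> iter n g x = x -> exists d, least_period g x d.
Proof.
move=> n0 gx; pose P k := (0 < k)%N && `[< iter k g x = x >].
have exP : exists k, P k by exists n; rewrite /P n0; apply/asboolP.
case: (ex_minnP exP) => d /andP[d0 /asboolP gd] dmin; exists d; split=> // k k0 gk.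
by apply: dmin; rewrite /P k0; apply/asboolP.
Qed.

Lemma least_period_dvdn (S : Type) (g : S -> S) (x : S) (d n : nat) :
  least_period g x d -> (iter n g x = x <-> (d %| n)%N).
Proof.
move=> [d0 gd dmin]; split=> [gn|]; last exact: iter_dvdn.
have gr : iter (n %% d) g x = x.
  by move: gn; rewrite {1}(divn_eq n d) addnC iterD (iter_dvdn gd) ?dvdn_mull.
rewrite /dvdn eqn0Ngt; apply/negP => r0.
by have := dmin _ r0 gr; rewrite leqNgt ltn_mod d0.
Qed.

Lemma least_period_next (S : Type) (g : S -> S) (x : S) (n : nat) :
  least_period g x n -> least_period g (g x) n.
Proof.
move=> lp; have [n0 gn nmin] := lp.
split=> // [|k k0 gk]; first by rewrite -iterSr iterS gn.
(* Since g^n x = x, applying g^(n-1) to g^k (g x) = g x gives g^k x = x, and minimality of [n] at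
   [x] applies. *)
have gx : iter n.-1 g (g x) = x by rewrite -iterSr prednK.
by apply: nmin => //; rewrite -[in LHS]gx -iterD addnC iterD gk gx.
Qed.

(** If the least period d were a proper divisor of n, any prime factor p of n/d would satisfy d |
    n/p, so x would already return after n/p steps. *)
Lemma least_periodP (S : Type) (g : S -> S) (x : S) (n : nat) : (0 < n)%N ->
  least_period g x n <->
  iter n g x = x /\ forall p, prime p -> (p %| n)%N -> iter (n %/ p) g x <> x.
Proof.
move=> n0; split=> [lp|[gn gnp]].
  split=> [|p pp pn /(least_period_dvdn _ lp)]; first by case: lp.
  move=> /dvdn_leq; rewrite divn_gt0 ?prime_gt0// dvdn_leq// => /(_ isT).
  by rewrite leqNgt ltn_Pdiv ?prime_gt1.
have [d lp] := ex_least_period n0 gn.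
have dn := (least_period_dvdn n lp).1 gn.
have [d0 _ _] := lp.
have [nd1|nd1] := eqVneq (n %/ d)%N 1%N.
  by rewrite -(divnK dn) nd1 mul1n.
have nd : (1 < n %/ d)%N by rewrite ltn_neqAle eq_sym nd1 divn_gt0// dvdn_leq.
have pn := dvdn_trans (pdiv_dvd (n %/ d)) (dvdn_div dn).
case: (gnp _ (pdiv_prime nd) pn); apply/(least_period_dvdn _ lp).
by rewrite dvdn_divRL// mulnC -dvdn_divRL// pdiv_dvd.
Qed.

(** * Products of distinct primes dividing the exponent *)

Lemma dvdn_prod_primes (ps : seq nat) (T : {set 'I_(size ps)}) (n : nat) :
  uniq ps -> all prime ps ->
  (\prod_(i in T) nth 1 ps i %| n)%N = [forall (i | i \in T), nth 1 ps i %| n]%N.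
Proof.
move=> ups pps; rewrite -big_enum.
have -> : [forall (i | i \in T), nth 1 ps i %| n]%N =
          all (fun i : 'I__ => nth 1 ps i %| n)%N (enum T).
  by apply/forall_inP/allP => H i; have := H i; rewrite mem_enum.
elim: (enum T) (enum_uniq T) => [|i r IHr] /=; first by rewrite big_nil dvd1n.
(* Distinct primes are pairwise coprime, so Gauss's lemma splits off one factor at a time. *)
move=> /andP[ir ur]; rewrite big_cons Gauss_dvd ?IHr//.
rewrite big_seq; apply: (big_ind (coprime (nth 1 ps i)%N)) => [|a b ia ib|j jr]; first exact: coprimen1.
  by rewrite coprimeMr ia ib.
rewrite prime_coprime ?(allP pps) ?mem_nth// dvdn_prime2 ?(allP pps) ?mem_nth//.
by rewrite nth_uniq//; apply: contraNneq ir => /val_inj ->.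
Qed.

Lemma iter_divn_prod_primes (S : Type) (g : S -> S) (x : S) (n : nat)
    (ps : seq nat) (T : {set 'I_(size ps)}) :
  (0 < n)%N -> uniq ps -> all prime ps -> (forall p, p \in ps -> p %| n)%N ->
  iter n g x = x ->
  iter (n %/ \prod_(i in T) nth 1 ps i)%N g x = x <->
  forall i, i \in T -> iter (n %/ nth 1 ps i)%N g x = x.
Proof.
move=> n0 ups pps psn gn; have [d lp] := ex_least_period n0 gn.
have dn := (least_period_dvdn n lp).1 gn.
have divnP q : (q %| n)%N -> iter (n %/ q) g x = x <-> (q %| n %/ d)%N.
  move=> qn; rewrite dvdn_divRL// mulnC -dvdn_divRL//.
  exact: least_period_dvdn.
have psin (i : 'I_(size ps)) : (nth 1 ps i %| n)%N by apply/psn/mem_nth.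
have Tn : (\prod_(i in T) nth 1 ps i %| n)%N.
  by rewrite dvdn_prod_primes//; apply/forall_inP.
rewrite divnP// dvdn_prod_primes//; split=> [/forall_inP H i iT|H].
  by apply/divnP => //; exact: H.
by apply/forall_inP => i iT; apply/divnP => //; exact: H.
Qed.

(** * Inclusion-exclusion and counting by orbits *)

Lemma ncard_subset (T : Type) (A B : set T) : finite_set A -> B `<=` A ->
  ncard B = (\sum_(x <- fset_set (A : set {classic T})) `[< B x >])%N.
Proof.
move=> finA BA; have finB := sub_finite_set BA finA.
transitivity (count (fun x => `[< B x >]) (fset_set (A : set {classic T}))).
  rewrite -size_filter /ncard; apply: perm_size.
  apply: uniq_perm => [||x]; rewrite ?filter_uniq ?fset_uniq//.
  rewrite mem_filter (in_fset_set (finB : finite_set (B : set {classic T}))).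
  rewrite (in_fset_set (finA : finite_set (A : set {classic T}))) /=.
  apply/idP/andP => [|[/asboolP Bx _]]; last exact/mem_set.
  by move=> /set_mem Bx; split; [apply/asboolP|exact/mem_set/BA].
by rewrite -sum1_count big_mkcond.
Qed.

(** The left side is the expansion over subsets of the product of the factors 1 - [P i], which
    vanishes as soon as one [P i] holds. *)
Lemma sum_sign_forall_in (I : finType) (P : pred I) :
  \sum_(T : {set I}) (-1) ^+ #|T| * ([forall (i | i \in T), P i] : nat)%:Z
  = ([forall i, ~~ P i] : nat)%:Z.
Proof.
transitivity (\prod_i (- (P i : nat)%:Z + 1)); last first.
  have [/forallP H|/forallPn[i]] := boolP [forall i, ~~ P i].
    by rewrite big1// => i _; rewrite (negPf (H i)).
  by rewrite negbK => Pi; rewrite (bigD1 i)//= Pi mul0r.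
rewrite bigA_distr; apply: eq_bigr => T _; rewrite -big_mkcond/= prodrN.
congr (_ * _); have [/forall_inP H|/forall_inPn[i iT]] := boolP [forall i in T, P i].
  by rewrite big1// => i /H ->.
by move=> /negPf nPi; rewrite (bigD1 i)//= nPi mul0r.
Qed.

(** [A k] stands for the solutions at exponent k, and [C p] for the extra equation that a point of
    [A m] must solve when m is divided by p. The signs attached to a point of [A m] add up to 1 if
    it solves none of the extra equations, and to 0 otherwise. *)
Lemma alt_sum_ncard (S : Type) (A C : nat -> set S) (ps : seq nat) (m : nat) :
  finite_set (A m) ->
  (forall (T : {set 'I_(size ps)}) x,
    A (m %/ \prod_(i in T) nth 1 ps i)%N x <->
    A m x /\ forall i, i \in T -> C (nth 1%N ps i) x) ->
  alt_sum ps m (fun k => (ncard (A k))%:Z) =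
  (ncard [set x | A m x /\ forall p, p \in ps -> ~ C p x])%:Z.
Proof.
move=> finA AC; set X := fset_set (A m : set {classic S}).
(* Every cardinality becomes a sum over the one finite set [A m], so that the sums over [T] and over
   points can be exchanged. *)
rewrite (@ncard_subset _ (A m))//; last by move=> x [].
rewrite /alt_sum /=; under eq_bigr => T _.
  rewrite (@ncard_subset _ (A m))//; last by move=> x /AC[].
  rewrite (big_morph Posz PoszD erefl) mulr_sumr; over.
rewrite (big_morph Posz PoszD erefl) exchange_big/= big_seq_cond [RHS]big_seq_cond.
apply: eq_bigr => x; rewrite andbT.
rewrite (in_fset_set (finA : finite_set (A m : set {classic S}))) inE => Ax.
pose P (i : 'I_(size ps)) := `[< C (nth 1%N ps i) x >].
transitivity (([forall i, ~~ P i] : nat)%:Z).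
  rewrite -sum_sign_forall_in; apply: eq_bigr => T _; congr (_ * _%:Z).
  congr nat_of_bool; apply/asboolP/forall_inP => [/AC[_ H] i iT|H].
    by apply/asboolP; exact: H.
  by apply/AC; split=> // i /H/asboolP.
congr ((nat_of_bool _)%:Z); apply/forallP/asboolP => [H|[_ H] i].
  split=> // p /(nthP 1%N)[i ips <-].
  by have /asboolPn := H (Ordinal ips).
by apply/asboolPn/H/mem_nth.
Qed.

(** As g^n is the identity on [A], the restriction [f] of g is a permutation of [A]. All its cycles
    have length n, so the cardinality is n times the number of cycles. *)
Lemma dvdn_ncard_least_period (S : Type) (g : S -> S) (A : set S) (n : nat) :
  finite_set A -> (forall x, A x -> A (g x)) ->
  (forall x, A x -> least_period g x n) -> (n %| ncard A)%N.
Proof.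
move=> finA gA lpA; pose X := fset_set (A : set {classic S}).
have XP (x : {classic S}) : x \in X <-> A x.
  by rewrite (in_fset_set (finA : finite_set (A : set {classic S}))) inE.
have gX (x : X) : (g (val x) : {classic S}) \in X by apply/XP/gA/XP/valP.
pose f (x : X) : X := [` gX x]%fset.
have iterf k (x : X) : val (iter k f x) = iter k g (val x).
  by elim: k => //= k ->.
have lp (x : X) : least_period g (val x) n by apply/lpA/XP/valP.
have fn (x : X) : iter n f x = x by apply: val_inj; rewrite iterf; case: (lp x).
have finj : injective f.
  move=> x y fxy; have [n0 _ _] := lp x.
  by rewrite -(fn x) -(fn y) -(prednK n0) !iterSr fxy.
have ordf (x : X) : order f x = n.
  apply/eqP; rewrite eqn_dvd; apply/andP; split; last first.
    by apply/(least_period_dvdn _ (lp x)); rewrite -iterf iter_order.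
  have lpf : least_period f x (order f x).
    split; [exact: order_gt0|exact: iter_order|move=> k k0 fk].
    (* A return after k < [order f x] steps would give [x] the index k in its own cycle, while that
       index is 0. *)
    rewrite leqNgt; apply/negP => kx.
    have := findex_iter kx; rewrite fk findex0 => k1.
    by rewrite -k1 in k0.
  by apply/(least_period_dvdn _ lpf).
rewrite /ncard cardfE -(@fcard_order_set _ f finj n predT).
- exact: dvdn_mull.
- by apply/fintype.subsetP => x _; rewrite inE ordf.
- by [].
Qed.

Lemma ncard_setD1 (T : Type) (A : set T) (x : T) :
  finite_set A -> A x -> (ncard (A `\ x)%classic)%:Z = (ncard A)%:Z - 1.
Proof.
move=> finA Ax; rewrite /ncard.
rewrite (fset_setD1 (x : {classic T}) (finA : finite_set (A : set {classic T}))).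
rewrite [in RHS](cardfsD1 (x : {classic T})).
rewrite (in_fset_set (finA : finite_set (A : set {classic T}))) (mem_set Ax).
by rewrite PoszD addrC addKr.
Qed.

(** * Points of least period m *)

Lemma ncard_least_period (S : Type) (g : S -> S) (m : nat) :
  (0 < m)%N -> finite_set [set x | iter m g x = x] ->
  (ncard [set y | periodic_point g y /\ least_period g y m])%:Z
  = Phi1 m (fun k => (ncard [set x | iter k g x = x])%:Z).
Proof.
move=> m0 fin; pose C p := [set x | iter (m %/ p) g x = x].
have -> : Phi1 m (fun k => (ncard [set x | iter k g x = x])%:Z) =
    alt_sum (primes m) m (fun k => (ncard [set x | iter k g x = x])%:Z).
  (* For m = 1 there are no primes, and the only subset, the empty one, contributes phi(1). *)
  rewrite /Phi1; have [->|//] := eqVneq m 1%N.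
  rewrite /alt_sum (big_pred1 finset.set0); last first.
    by move=> T; apply/esym/eqP/setP => -[].
  by rewrite cards0 big_set0 mul1r.
have pps : all prime (primes m).
  by apply/allP => p; rewrite mem_primes => /andP[].
rewrite (@alt_sum_ncard _ _ C)//=; last first.
  have psm p : p \in primes m -> (p %| m)%N by rewrite mem_primes => /and3P[].
  move=> T x; split=> [gT|[gm gC]].
    have gm : iter m g x = x.
      apply: iter_dvdn gT _; apply: dvdn_div.
      rewrite dvdn_prod_primes ?primes_uniq//.
      by apply/forall_inP => i _; apply/psm/mem_nth.
    by split=> //; apply/(iter_divn_prod_primes T m0 (primes_uniq m) pps psm gm).
  by apply/(iter_divn_prod_primes T m0 (primes_uniq m) pps psm gm).
congr (ncard _)%:Z; apply/seteqP; split=> x /=.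
  move=> [_ /(least_periodP _ _ m0)[gm gp]]; split=> // p.
  by rewrite mem_primes => /and3P[pp _ pm]; exact: gp.
move=> [gm gp]; split; first by exists m.
by apply/least_periodP => //; split=> // p pp pm; apply: gp; rewrite mem_primes pp m0.
Qed.

(** * Odd maps and symmetric periodic points *)

Lemma odd_prod_seq (ps : seq nat) (T : {set 'I_(size ps)}) :
  all odd ps -> odd (\prod_(i in T) nth 1 ps i)%N.
Proof.
move=> ops; apply: (big_ind odd) => // [a b oa ob|i _]; first by rewrite oddM oa.
by apply: (allP ops); rewrite mem_nth.
Qed.

(** Translates the case distinction of [Phi2] into one on the list of odd primes dividing m. *)
Lemma odd_primes_eq_nil m : (0 < m)%N ->
  ([seq p <- primes m | odd p] == [::]) = (m == 2 ^ logn 2 m)%N.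
Proof.
move=> m0; apply/eqP/eqP => [ps0|mE].
  rewrite -p_part part_pnat_id//; apply/pnatP => // p pp pm.
  have [->//|op] := even_prime pp.
  by have : p \in [::] by rewrite -ps0 mem_filter op mem_primes pp m0.
apply/eqP; rewrite -[_ == _]negbK -has_filter -all_predC; apply/allP => p /=.
rewrite mem_primes => /and3P[pp _]; rewrite mE.
by rewrite Euclid_dvdX// dvdn_prime2// => /andP[/eqP -> _].
Qed.

Section Antisymmetric.
(** [h] abstracts x -> -x, and [gh] the oddness of g. Where the origin matters, it appears as the
    unique fixed point [z] of [h]. *)
Variables (S : Type) (g h : S -> S).
Hypotheses (hK : involutive h) (gh : forall x, g (h x) = h (g x)).

Lemma iter_commute k x : iter k g (h x) = h (iter k g x).
Proof. by elim: k => //= k ->; rewrite gh. Qed.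

Lemma iter_double_id m x : iter m g x = h x -> iter (2 * m) g x = x.
Proof. by move=> gm; rewrite mul2n -addnn iterD gm iter_commute gm hK. Qed.

(* As q is odd, (q - 1) * m / q is a multiple of 2 * m / q, so that
   g^m x = g^(m/q) x as soon as g^(2m/q) x = x. *)
Lemma iter_divn_odd m q x : odd q -> (q %| m)%N ->
  iter (m %/ q) g x = h x <->
  iter m g x = h x /\ iter (2 * m %/ q) g x = x.
Proof.
move=> oq qm; rewrite -muln_divA//.
have key : iter (2 * (m %/ q)) g x = x -> iter m g x = iter (m %/ q) g x.
  move=> g2; rewrite -{1}(divnK qm) -{2}(odd_double_half q) oq mulnDr muln1.
  by rewrite iterD (iter_dvdn g2)// -mul2n mulnA (mulnC _ 2) dvdn_mulr.
split=> [gq|[gm g2]]; last by rewrite -key.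
by have g2 := iter_double_id gq; rewrite key.
Qed.

(** From g^k x = h x follows g^(2k) x = x, hence 2m | 2k and k = qm. An even q would give h x = x;
    for odd q, g^k x = g^m x. *)
Lemma ex_iter_antiperiodic m x : (0 < m)%N -> h x <> x ->
  least_period g x (2 * m) -> (exists k, iter k g x = h x) -> iter m g x = h x.
Proof.
move=> m0 hx lp [k gk]; have [_ g2m _] := lp.
have /(least_period_dvdn _ lp) := iter_double_id gk.
rewrite dvdn_pmul2l// => /dvdnP[q kE]; rewrite -gk kE.
have g2h : iter (q./2.*2 * m) g x = x.
  by apply: iter_dvdn g2m _; rewrite -mul2n -mulnA mulnCA dvdn_mull.
have [oq|eq] := boolP (odd q).
  by rewrite -(odd_double_half q) oq mulnDl mul1n iterD g2h.
by case: hx; rewrite -gk kE -[q]even_halfK.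
Qed.

Lemma symmetric_least_periodP m x z : (0 < m)%N ->
  (forall y, h y = y <-> y = z) ->
  least_period g x (2 * m) /\ (exists k, iter k g x = h x) <->
  [/\ iter m g x = h x, x <> z &
    forall p, p \in [seq p <- primes m | odd p] -> iter (2 * m %/ p) g x <> x].
Proof.
move=> m0 hz; have hzz : h z = z by apply/hz.
have gz : g z = z by apply/hz; rewrite -gh hzz.
have m20 : (0 < 2 * m)%N by rewrite muln_gt0.
split=> [[lp gk]|[gm xz gp]].
  have xz : x <> z.
    move=> xz; case: lp => _ _ /(_ 1%N isT); rewrite xz => /(_ gz).
    by rewrite leqNgt leq_pmulr.
  split=> //; first by apply: ex_iter_antiperiodic => // /hz.
  move=> p; rewrite mem_filter mem_primes => /and4P[_ pp _ pm].
  by have [_] := (least_periodP g x m20).1 lp; apply=> //; rewrite dvdn_mull.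
split; last by exists m.
apply/least_periodP => //; split; first exact: iter_double_id.
move=> p pp pm; have [p2|p2] := eqVneq p 2%N.
  (* At p = 2 the exponent 2m/p is m, and g^m x = h x differs from x away from [z]. *)
  by rewrite p2 mulKn// gm => /hz.
have op : odd p by have [] := even_prime pp => // /eqP; rewrite (negPf p2).
apply: gp; rewrite mem_filter op mem_primes pp m0/=.
by move: pm; rewrite Euclid_dvdM// dvdn_prime2// (negPf p2).
Qed.

(** A product of odd primes is odd, so [iter_divn_odd] trades each equation g^(m/q) x = h x for
    g^(2m/q) x = x on the solutions of g^m x = h x. Inclusion-exclusion then runs with exponent
    2m. *)
Lemma alt_sum_antiperiodic m : (0 < m)%N ->
  finite_set [set x | iter m g x = h x] ->
  alt_sum [seq p <- primes m | odd p] m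
    (fun k => (ncard [set x | iter k g x = h x])%:Z) =
  (ncard [set x | iter m g x = h x /\
    forall p, p \in [seq p <- primes m | odd p] -> iter (2 * m %/ p) g x <> x])%:Z.
Proof.
move=> m0 fin; set ps := filter _ _.
have ups : uniq ps by rewrite filter_uniq ?primes_uniq.
have psP p : p \in ps -> [/\ odd p, prime p & p %| m]%N.
  by rewrite mem_filter mem_primes => /and4P[].
have pps : all prime ps by apply/allP => p /psP[].
have ops : all odd ps by apply/allP => p /psP[].
pose C p := [set x | iter (2 * m %/ p) g x = x].
rewrite (@alt_sum_ncard _ _ C)// => T x.
have m20 : (0 < 2 * m)%N by rewrite muln_gt0.
have ps2m p : p \in ps -> (p %| 2 * m)%N by move=> /psP[_ _ /dvdn_mull].
rewrite /= iter_divn_odd ?odd_prod_seq//; last first.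
  rewrite dvdn_prod_primes//; apply/forall_inP => i _.
  by have [] := psP _ (mem_nth 1%N (ltn_ord i)).
split=> -[gm gT]; split=> //.
  exact/(iter_divn_prod_primes T m20 ups pps ps2m (iter_double_id gm)).
exact/(iter_divn_prod_primes T m20 ups pps ps2m (iter_double_id gm)).
Qed.

Lemma ncard_symmetric_least_period m z : (0 < m)%N ->
  (forall y, h y = y <-> y = z) ->
  finite_set [set x | iter m g x = h x] ->
  (ncard [set x | least_period g x (2 * m) /\ exists k, iter k g x = h x])%:Z =
  Phi2 m (fun k => (ncard [set x | iter k g x = h x])%:Z).
Proof.
move=> m0 hz fin; have hzz : h z = z by apply/hz.
have gz : g z = z by apply/hz; rewrite -gh hzz.
have giz k : iter k g z = z by elim: k => //= k ->.
rewrite /Phi2 -odd_primes_eq_nil//; case: eqVneq => ps0.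
  (* For m a power of 2 only [z] has to be removed, whence the -1 in [Phi2]. *)
  rewrite -(@ncard_setD1 _ _ z)//=; last by rewrite giz hzz.
  congr (ncard _)%:Z; apply/seteqP; split=> x /=.
    by move=> /(symmetric_least_periodP _ m0 hz)[].
  move=> [gm xz]; apply/(symmetric_least_periodP _ m0 hz).
  by split=> //; rewrite ps0.
rewrite alt_sum_antiperiodic//.
congr (ncard _)%:Z; apply/seteqP; split=> x /=.
  by move=> /(symmetric_least_periodP _ m0 hz)[].
move=> [gm gp]; apply/(symmetric_least_periodP _ m0 hz); split=> // xz.
(* Some odd prime p divides m, and the fixed point [z] of g solves the excluded equation at exponent
   2m/p. *)
case: [seq p <- primes m | odd p] gp ps0 => // p ps gp _.
by apply: (gp p); rewrite ?mem_head// xz giz.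
Qed.

End Antisymmetric.

(** One iterate equal to -y is enough for symmetry of the orbit: if g^k y = -y, oddness gives -g^j y
    = g^(j+k) y for all j. *)
Lemma symmetric_periodic_pointP (R : realType) (S : set R) (g h : S -> S) (y : S) :
  (forall x, val (h x) = - val x) -> (forall x, g (h x) = h (g x)) ->
  symmetric_periodic_point g y <->
  periodic_point g y /\ exists k, iter k g y = h y.
Proof.
move=> hN gh; rewrite /symmetric_periodic_point /=.
have hK : involutive h by move=> x; apply: val_inj; rewrite !hN opprK.
split=> -[per sym]; split=> //.
  have : [set - z | z in [set val z | z in orbit_set g y]] (- val y).
    by exists (val y) => //; exists y => //; exists 0%N.
  rewrite sym => -[_ [k _ <-] ky]; exists k; apply: val_inj.
  by rewrite hN; exact: ky.
have [k gk] := sym.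
have orbN x : orbit_set g y x -> orbit_set g y (h x).
  by move=> [j _ <-]; exists (j + k)%N => //; rewrite iterD gk iter_commute.
apply/seteqP; split=> [_ [_ [x /orbN yx <-] <-]|_ [x /orbN yx <-]].
  by exists (h x) => //; exact: hN.
by exists (val (h x)); [exists (h x)|rewrite hN opprK].
Qed.

(** * Both counting formulas and their congruences *)

Theorem theorem1 :
  (forall (S : Type) (g : S -> S),
    inhabited S ->
    (forall m : nat, (0 < m)%N -> finite_set [set x : S | iter m g x = x]) ->
    let phi := fun m : nat => (ncard [set x : S | iter m g x = x])%:Z in
    (forall m : nat, (0 < m)%N ->
      finite_set [set y : S | periodic_point g y /\ least_period g y m] /\
      (ncard [set y : S | periodic_point g y /\ least_period g y m])%:Z
        = Phi1 m phi) /\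
    (forall m : nat, (0 < m)%N -> (Phi1 m phi = 0 %[mod m%:Z])%Z))
  /\
  (forall (R : realType) (S : set R) (g : S -> S),
    S 0 ->
    (forall x : R, S x -> S (- x)) ->
    (forall x y : S, val y = - val x -> val (g y) = - val (g x)) ->
    (forall m : nat, (0 < m)%N ->
      finite_set [set x : S | val (iter m g x) = - val x]) ->
    let psi := fun m : nat =>
      (ncard [set x : S | val (iter m g x) = - val x])%:Z in
    (forall m : nat, (0 < m)%N ->
      finite_set
        [set y : S | symmetric_periodic_point g y /\ least_period g y (2 * m)%N]
      /\
      (ncard [set y : S | symmetric_periodic_point g y
                          /\ least_period g y (2 * m)%N])%:Z
        = Phi2 m psi) /\
    (forall m : nat, (0 < m)%N -> (Phi2 m psi = 0 %[mod (2 * m)%N%:Z])%Z)).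
Proof.
split=> [S g _ fin phi|R S g S0 SN gN fin psi].
  have finP m : (0 < m)%N ->
      finite_set [set y : S | periodic_point g y /\ least_period g y m].
    by move=> m0; apply: sub_finite_set (fin m m0) => x [_ []].
  split=> m m0; first by split; [exact: finP|exact/ncard_least_period/fin].
  apply/eqP; rewrite eqz_mod_dvd subr0 -ncard_least_period//; last exact: fin.
  apply: (@dvdn_ncard_least_period _ g); first exact: finP.
    move=> x [_ lp]; have lpg := least_period_next lp.
    by split=> //; exists m => //; case: lpg.
  by move=> x [].
(* Negation as a self-map of the subtype [S], which is closed under it; its only fixed point is the
   origin [z]. *)
pose h (x : S) : S := SigSub (mem_set (SN _ (set_mem (valP x)))).
have hN x : val (h x) = - val x by [].
have hK : involutive h by move=> x; apply: val_inj; rewrite !hN opprK.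
have gh x : g (h x) = h (g x) by apply: val_inj; rewrite hN; exact: gN.
pose z : S := SigSub (mem_set S0).
have hz y : h y = y <-> y = z.
  split=> [/(congr1 val)|->]; last by apply: val_inj; rewrite hN oppr0.
  rewrite hN => /eqP; rewrite eq_sym -addr_eq0 -mulr2n mulrn_eq0/= => /eqP y0.
  exact: val_inj.
have antiE m : [set x : S | val (iter m g x) = - val x] =
               [set x | iter m g x = h x].
  apply/seteqP; split=> x /= gx; first exact: val_inj.
  by rewrite gx hN.
have psiE : psi = fun k => (ncard [set x | iter k g x = h x])%:Z.
  by apply/funext => k; rewrite /psi antiE.
have finA m : (0 < m)%N -> finite_set [set x | iter m g x = h x].
  by move=> /fin; rewrite antiE.
have symE m : (0 < m)%N ->
    [set y : S | symmetric_periodic_point g y /\ least_period g y (2 * m)] =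
    [set x | least_period g x (2 * m) /\ exists k, iter k g x = h x].
  move=> m0; apply/seteqP; split=> x /=.
    by move=> [/(symmetric_periodic_pointP _ hN gh)[]].
  move=> [lp gk]; split=> //; apply/(symmetric_periodic_pointP _ hN gh).
  by split=> //; exists (2 * m)%N; case: lp.
have finP m : (0 < m)%N -> finite_set
    [set x | least_period g x (2 * m) /\ exists k, iter k g x = h x].
  move=> m0; apply: sub_finite_set (finA m m0) => x.
  by move=> /(symmetric_least_periodP hK gh _ m0 hz)[].
rewrite psiE; split=> m m0.
  rewrite symE//; split; first exact: finP.
  by rewrite (ncard_symmetric_least_period hK gh m0 hz)//; exact: finA.
apply/eqP; rewrite eqz_mod_dvd subr0.
rewrite -(ncard_symmetric_least_period hK gh m0 hz); last exact: finA.
apply: (@dvdn_ncard_least_period _ g); first exact: finP.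
  move=> x [lp [k gk]]; split; first exact: least_period_next.
  by exists k; rewrite -iterSr iterS gk gh.
by move=> x [].
Qed.
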